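(* Let $K$ be a number field of degree $n=[K:\mathbf{Q}]$. For $r\in\mathbf{Q}^*$, let $E_r$ be the elliptic curve $$E_r:\quad y^2=x\bigl(x^2-2(1-4r^4)x+(1+4r^4)^2\bigr).$$ Then for every $r\in\mathbf{Q}^*$, the adelic point group $E_r(\mathbf{A}_K)$ of $E_r$, viewed as an elliptic curve over $K$, is not isomorphic to the topological group $$\mathcal{E}_n=(\mathbf{R}/\mathbf{Z})^n\times\widehat{\mathbf{Z}}^n\times\prod_{m=1}^\infty \mathbf{Z}/m\mathbf{Z}.$$
   Context: Adelic point group: for an elliptic curve $E$ over a number field $K$, $E(\mathbf{A}_K)=\prod_{\mathfrak{p}\le\infty}E(K_\mathfrak{p})$, the product over all finite and infinite primes $\mathfrak{p}$ of $K$ of the point groups over the completions $K_\mathfrak{p}$, each with its natural ($\mathfrak{p}$-adic, real or complex) topology, and the product carrying the product topology. $\widehat{\mathbf{Z}}$ is the profinite completion of $\mathbf{Z}$; each $\mathbf{Z}/m\mathbf{Z}$ is discrete. Isomorphism means isomorphism of topological groups. *)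

(* Defs.v *)
From HB Require Import structures.
From mathcomp Require Import all_boot all_order all_algebra all_field.
From mathcomp Require Import all_classical all_reals all_analysis.
From mathcomp Require Import ring.

Set Implicit Arguments.
Unset Strict Implicit.
Unset Printing Implicit Defensive.

Import Order.TTheory GRing.Theory Num.Theory.
Import numFieldTopology.Exports numFieldNormedType.Exports.

Local Open Scope classical_set_scope.
Local Open Scope quotient_scope.
Local Open Scope ring_scope.

#[short(type="preTopologicalFieldType")]
HB.structure Definition PreTopologicalField := {F of GRing.Field F & Topological F}.

(* Real-valued, multiplicative, nontrivial; archimedean ones are included. *)
Record absval (R : realType) (K : fieldType) := Absval {
  absval_fun :> K -> R;
  absval_ge0 : forall x, 0 <= absval_fun x;
  absval_eq0 : forall x, absval_fun x = 0 <-> x = 0;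
  absvalM : {morph absval_fun : x y / x * y};
  ler_absvalD : forall x y, absval_fun (x + y) <= absval_fun x + absval_fun y;
  absval_nontrivial : exists2 x, x != 0 & absval_fun x != 1
}.

HB.instance Definition _ (R : realType) (K : fieldType) :=
  gen_eqMixin (absval R K).
HB.instance Definition _ (R : realType) (K : fieldType) :=
  gen_choiceMixin (absval R K).

Section AbsvalTheory.
Variables (R : realType) (K : fieldType) (v : absval R K).

Lemma absval0 : v 0 = 0. Proof. exact/absval_eq0. Qed.

Lemma absval_neq0 x : x != 0 -> v x != 0.
Proof. by move=> x0; apply: contraNneq x0 => /absval_eq0 ->. Qed.

Lemma absval_gt0 x : x != 0 -> 0 < v x.
Proof. by move=> x0; rewrite lt_neqAle absval_ge0 eq_sym absval_neq0. Qed.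

Lemma absval1 : v 1 = 1.
Proof.
have v1 : v 1 != 0 by apply: absval_neq0; exact: oner_neq0.
by apply: (mulfI v1); rewrite -absvalM !mulr1.
Qed.

Lemma absvalN x : v (- x) = v x.
Proof.
suff vN1 : v (-1) = 1 by rewrite -mulN1r absvalM vN1 mul1r.
apply/eqP; rewrite -(@eqrXn2 _ 2) ?absval_ge0 ?ler01 //.
by rewrite expr2 -absvalM mulrNN mulr1 absval1 expr1n.
Qed.

Lemma absvalV x : x != 0 -> v x^-1 = (v x)^-1.
Proof.
move=> x0; apply: (mulfI (absval_neq0 x0)).
by rewrite -absvalM !mulfV ?absval1 ?absval_neq0.
Qed.

Lemma absvalBC x y : v (x - y) = v (y - x).
Proof. by rewrite -absvalN opprB. Qed.

Lemma ler_absvalB x y z : v (x - z) <= v (x - y) + v (y - z).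
Proof. by rewrite -[x - z](subrKA y) ler_absvalD. Qed.

Lemma ler_dist_absval x y : `|v x - v y| <= v (x - y).
Proof.
have le a b : v a - v b <= v (a - b).
  by rewrite lerBlDr -{1}[a](subrK b) ler_absvalD.
by rewrite ler_norml le andbT lerNl opprB absvalBC le.
Qed.

End AbsvalTheory.

Section Prime.
Variables (R : realType) (K : fieldType).

Definition absval_equiv (v w : absval R K) : bool :=
  `[< exists2 s : R, 0 < s & forall x, w x = v x `^ s >].

Lemma absval_equiv_class : equiv_class_of absval_equiv.
Proof.
have sym v w : absval_equiv v w -> absval_equiv w v.
  move=> /asboolP[s s0 vw]; apply/asboolP; exists s^-1; first by rewrite invr_gt0.
  move=> x; rewrite vw -powRrM mulfV ?gt_eqF //.
  by rewrite powRr1 // absval_ge0.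
split.
- move=> v; apply/asboolP; exists 1 => // x.
  by rewrite powRr1 // absval_ge0.
- by move=> v w; apply/idP/idP; apply: sym.
- move=> v u w /asboolP[s s0 vu] /asboolP[t t0 uw]; apply/asboolP.
  exists (s * t); first by rewrite mulr_gt0.
  by move=> x; rewrite uw vu powRrM.
Qed.

Canonical absval_equiv_equiv := EquivRelPack absval_equiv_class.
Canonical absval_equiv_encModRel := defaultEncModRel absval_equiv.

(* A prime (place), finite or infinite, is an equivalence class of nontrivial
   absolute values. *)
Definition place := {eq_quot absval_equiv}.

End Prime.

Section Completion.
Variables (R : realType) (K : fieldType) (v : absval R K).

Definition is_cauchy (u : nat -> K) : bool :=
  `[< forall e : R, 0 < e -> exists N, forall m n,
        (N <= m)%N -> (N <= n)%N -> v (u m - u n) < e >].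

Record cauchy_seq :=
  CauchySeq { cauchy_val :> nat -> K; _ : is_cauchy cauchy_val }.
HB.instance Definition _ := [isSub for cauchy_val].
HB.instance Definition _ := [Choice of cauchy_seq by <:].

Lemma is_cauchyP (u : nat -> K) : reflect (forall e : R, 0 < e -> exists N,
  forall m n, (N <= m)%N -> (N <= n)%N -> v (u m - u n) < e) (is_cauchy u).
Proof. exact: asboolP. Qed.

Lemma cauchy_bounded u : is_cauchy u ->
  exists2 M : R, 0 < M & exists N, forall n, (N <= n)%N -> v (u n) < M.
Proof.
move=> /is_cauchyP/(_ 1 ltr01)[N uN]; exists (1 + v (u N)).
  by rewrite ltr_wpDr ?absval_ge0.
exists N => n Nn; rewrite -[u n](subrK (u N)).
by rewrite (le_lt_trans (ler_absvalD _ _ _)) // ltrD2r uN.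
Qed.

Lemma is_cauchy_subring : subring_closed is_cauchy.
Proof.
split.
- apply/is_cauchyP => e e0; exists 0%N => m n _ _.
  by rewrite subrr absval0.
- move=> a b /is_cauchyP ca /is_cauchyP cb; apply/is_cauchyP => e e0.
  have e2 : 0 < e / 2 by rewrite divr_gt0.
  have [N aN] := ca _ e2; have [M bM] := cb _ e2.
  exists (maxn N M) => m n; rewrite !geq_max => /andP[Nm Mm] /andP[Nn Mn].
  rewrite [X in v X](_ : _ = (a m - a n) + (b n - b m)); last first.
    by rewrite -[LHS]/((a m - b m) - (a n - b n)); ring.
  by rewrite (le_lt_trans (ler_absvalD _ _ _)) // [e]splitr ltrD ?aN ?bM.
- move=> a b ca cb; apply/is_cauchyP => e e0.
  have [A A0 [NA aA]] := cauchy_bounded ca.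
  have [B B0 [NB bB]] := cauchy_bounded cb.
  have eA : 0 < e / 2 / A by rewrite !divr_gt0.
  have eB : 0 < e / 2 / B by rewrite !divr_gt0.
  have [N aN] := is_cauchyP _ ca _ eB; have [M bM] := is_cauchyP _ cb _ eA.
  exists (maxn (maxn N M) (maxn NA NB)) => m n; rewrite !geq_max.
  move=> /andP[/andP[Nm Mm] /andP[Am Bm]] /andP[/andP[Nn Mn] /andP[An Bn]].
  rewrite [X in v X](_ : _ = (a m - a n) * b m + a n * (b m - b n)); last first.
    by rewrite -[LHS]/(a m * b m - a n * b n); ring.
  rewrite (le_lt_trans (ler_absvalD _ _ _)) // [e]splitr !absvalM.
  rewrite ltrD //.
    rewrite -[e / 2](divfK (lt0r_neq0 B0)) ltr_pM ?absval_ge0 ?aN ?bB //.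
  rewrite -[e / 2](divfK (lt0r_neq0 A0)) [X in _ < X]mulrC.
  by rewrite ltr_pM ?absval_ge0 ?aA ?bM.
Qed.

HB.instance Definition _ :=
  GRing.isSubringClosed.Build (nat -> K) is_cauchy is_cauchy_subring.
HB.instance Definition _ := [SubChoice_isSubComNzRing of cauchy_seq by <:].

Definition is_null : {pred cauchy_seq} :=
  fun u => `[< v (u n) @[n --> \oo] --> (0 : R) >].

Lemma is_nullP (u : cauchy_seq) :
  reflect (v (u n) @[n --> \oo] --> (0 : R)) (is_null u).
Proof. exact: asboolP. Qed.

Lemma cauchy_absval_cvg (u : cauchy_seq) : cvgn (fun n => v (u n)).
Proof.
apply/cauchy_cvgP/cauchy_ballP => e e0.
have [N uN] := is_cauchyP _ (valP u) _ e0.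
near_simpl; near=> m n; rewrite /ball /=.
apply: (le_lt_trans (ler_dist_absval _ _ _)); apply: uN.
- by near: m; exists N.
- by near: n; exists N.
Unshelve. all: by end_near. Qed.

Lemma cauchy_away_null (u : cauchy_seq) : ~~ is_null u ->
  exists2 d : R, 0 < d & exists N, forall n, (N <= n)%N -> d < v (u n).
Proof.
move=> u0; have /cvg_ex[/= l ul] := @cauchy_absval_cvg u.
have l0 : 0 < l.
  rewrite lt_neqAle eq_sym; apply/andP; split.
    by apply: contraNneq u0 => l0; apply/is_nullP; rewrite -l0.
  rewrite -(cvg_lim _ ul) //; apply: limr_ge; first by apply/cvg_ex; exists l.
  by apply: nearW => n; exact: absval_ge0.
exists (l / 2); first by rewrite divr_gt0.
have [N _ uN] : \forall n \near \oo, l / 2 < v (u n).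
  by apply: (cvgr_gt _ ul); rewrite ltr_pdivrMr // ltr_pMr // ltr1n.
by exists N => n /uN.
Qed.

Lemma is_null_idealr : idealr_closed is_null.
Proof.
split.
- apply/is_nullP; rewrite (_ : (fun n => _) = cst 0); first exact: cvg_cst.
  by apply/funext => n; rewrite /= absval0.
- apply/negP => /is_nullP; rewrite (_ : (fun n => _) = cst 1); last first.
    by apply/funext => n; rewrite /= absval1.
  move=> /(cvg_lim (@Rhausdorff R)); rewrite lim_cst // => /eqP.
  by rewrite oner_eq0.
- move=> a b c /is_nullP b0 /is_nullP c0; apply/is_nullP.
  have [M M0 [N aM]] := cauchy_bounded (valP a).
  apply: (@squeeze_cvgr _ _ _ _ (cst 0) (fun n => M * v (b n) + v (c n))).
  - near=> n; rewrite absval_ge0 /=.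
    apply: (le_trans (ler_absvalD _ _ _)); rewrite lerD2r absvalM.
    rewrite ler_wpM2r ?absval_ge0 // ltW // aM //.
    by near: n; exists N.
  - exact: cvg_cst.
  - rewrite -[X in _ --> X](_ : M * 0 + 0 = 0); last by rewrite mulr0 addr0.
    by apply: cvgD => //; apply: cvgMr.
Unshelve. all: by end_near. Qed.

HB.instance Definition _ := isIdealr.Build cauchy_seq is_null is_null_idealr.

Definition completion : Type := {ideal_quot is_null}.

HB.instance Definition _ := GRing.ComNzRing.on completion.
HB.instance Definition _ := EqQuotient.on completion.

Lemma completion_eqP (a b : cauchy_seq) :
  reflect (\pi_completion a = \pi_completion b) (is_null (a - b)).
Proof. by apply: (iffP idP) => [ab|/eqP]; [apply/eqP|]; rewrite -Quotient.idealrBE. Qed.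

Lemma pi_completion0 : \pi_completion 0 = 0.
Proof. by rewrite piE. Qed.

Lemma pi_completion1 : \pi_completion 1 = 1.
Proof. by rewrite piE. Qed.

Lemma pi_completionB : {morph \pi_completion : a b / a - b}.
Proof. by move=> a b; rewrite !piE. Qed.

Lemma pi_completionM : {morph \pi_completion : a b / a * b}.
Proof. by move=> a b; rewrite !piE. Qed.

Definition completion_inv (x : completion) : completion :=
  if x == 0 then 0 else
  \pi_completion (insubd (0 : cauchy_seq) (fun n => (repr x n)^-1)).

Lemma is_cauchy_inv (u : cauchy_seq) :
  ~~ is_null u -> is_cauchy (fun n => (u n)^-1).
Proof.
move=> /cauchy_away_null[d d0 [N uN]]; apply/is_cauchyP => e e0.
have [M uM] := is_cauchyP _ (valP u) (e * (d * d)) ltac:(by rewrite !mulr_gt0).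
exists (maxn N M) => m n; rewrite !geq_max => /andP[Nm Mm] /andP[Nn Mn].
have um : u m != 0.
  by apply: contraTneq (uN m Nm) => ->; rewrite absval0 -leNgt ltW.
have un : u n != 0.
  by apply: contraTneq (uN n Nn) => ->; rewrite absval0 -leNgt ltW.
rewrite (_ : _ - _ = (u n - u m) * ((u m)^-1 * (u n)^-1)); last first.
  by field; rewrite um un.
rewrite !absvalM !absvalV // -invfM ltr_pdivrMr; last first.
  by rewrite mulr_gt0 ?absval_gt0.
apply: lt_le_trans (uM _ _ Mn Mm) _.
by rewrite ler_pM2l // ler_pM ?(ltW d0) // ltW ?uN.
Qed.

Lemma completion_mulVf (x : completion) : x != 0 -> completion_inv x * x = 1.
Proof.
move=> x0; have ux : ~~ is_null (repr x).
  apply: contra x0 => x0; rewrite -[x]reprK -pi_completion0.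
  by apply/eqP/completion_eqP; rewrite subr0.
rewrite /completion_inv (negPf x0) -[X in _ * X]reprK.
rewrite -pi_completionM -pi_completion1.
apply/completion_eqP/is_nullP.
have [d d0 [N uN]] := cauchy_away_null ux.
apply: (@cvg_near_cst _ _ (0 : R)).
near=> n.
have un : repr x n != 0.
  apply: contraTneq (uN n _) => [->|]; first by rewrite absval0 -leNgt ltW.
  by near: n; exists N.
apply/absval_eq0; rewrite /= insubdK; last exact: is_cauchy_inv.
by rewrite -[LHS]/((repr x n)^-1 * repr x n - 1) mulVf // subrr.
Unshelve. all: by end_near. Qed.

Lemma completion_inv0 : completion_inv 0 = 0.
Proof. by rewrite /completion_inv eqxx. Qed.

HB.instance Definition _ :=
  GRing.ComNzRing_isField.Build completion completion_mulVf completion_inv0.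

Definition completion_absval (x : completion) : R :=
  limn (fun n => v (repr x n)).

Lemma completion_absval_pi (a : cauchy_seq) :
  v (a n) @[n --> \oo] --> completion_absval (\pi_completion a).
Proof.
rewrite /completion_absval; set b := repr _.
have /is_nullP ab : is_null (a - b) by apply/completion_eqP; rewrite /b reprK.
have bl := @cauchy_absval_cvg b.
rewrite -[X in _ --> X]add0r (_ : (fun n => _) =
  (fun n => (v (a n) - v (b n)) + v (b n))); last first.
  by apply/funext => n; rewrite subrK.
apply: cvgD => //; apply: norm_cvg0.
apply: (@squeeze_cvgr _ _ _ _ (cst 0) (fun n => v ((a - b) n))) => //.
- by apply: nearW => n; rewrite normr_ge0 ler_dist_absval.
- exact: cvg_cst.
Qed.

Definition completion_dist (x y : completion) : R := completion_absval (x - y).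

Lemma completion_dist_pi (a b : cauchy_seq) : v (a n - b n) @[n --> \oo] -->
  completion_dist (\pi_completion a) (\pi_completion b).
Proof.
by rewrite /completion_dist -pi_completionB; exact: completion_absval_pi.
Qed.

Arguments completion_dist_pi : clear implicits.

Lemma completion_distxx x : completion_dist x x = 0.
Proof.
rewrite -[x]reprK; have /(cvg_lim (@Rhausdorff R)) <- :=
  completion_dist_pi (repr x) (repr x).
under eq_fun do rewrite subrr absval0.
exact: lim_cst.
Qed.

Lemma completion_dist_positivity x y : completion_dist x y = 0 -> x = y.
Proof.
rewrite -[x]reprK -[y]reprK => xy; apply/completion_eqP/is_nullP.
by rewrite -xy; exact: completion_dist_pi.
Qed.

Lemma completion_distC x y : completion_dist x y = completion_dist y x.
Proof.
rewrite -[x]reprK -[y]reprK.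
have /(cvg_lim (@Rhausdorff R)) <- := completion_dist_pi (repr x) (repr y).
have /(cvg_lim (@Rhausdorff R)) <- := completion_dist_pi (repr y) (repr x).
by under eq_fun do rewrite absvalBC.
Qed.

Lemma completion_dist_triangle y x z :
  completion_dist x z <= completion_dist x y + completion_dist y z.
Proof.
rewrite -[x]reprK -[y]reprK -[z]reprK.
apply: (ler_cvg_to (completion_dist_pi _ _)
  (cvgD (completion_dist_pi _ _) (completion_dist_pi _ _))).
by apply: nearW => n; exact: ler_absvalB.
Qed.

HB.instance Definition _ := isMetric.Build R completion completion_distxx
  completion_dist_positivity completion_distC completion_dist_triangle.

Lemma is_cauchy_cst (x : K) : is_cauchy (fun=> x).
Proof.
by apply/is_cauchyP => e e0; exists 0%N => m n _ _; rewrite subrr absval0.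
Qed.

Definition to_completion (x : K) : completion :=
  \pi_completion (CauchySeq (is_cauchy_cst x)).

Lemma to_completion_is_zmod_morphism : zmod_morphism to_completion.
Proof.
by move=> x y; rewrite -pi_completionB; congr (\pi_completion _); apply: val_inj.
Qed.

Lemma to_completion_is_monoid_morphism : monoid_morphism to_completion.
Proof.
split; first by rewrite -pi_completion1; congr (\pi_completion _); apply: val_inj.
by move=> x y; rewrite -pi_completionM; congr (\pi_completion _); apply: val_inj.
Qed.

HB.instance Definition _ := GRing.isZmodMorphism.Build K completion to_completion
  to_completion_is_zmod_morphism.
HB.instance Definition _ := GRing.isMonoidMorphism.Build K completion
  to_completion to_completion_is_monoid_morphism.

End Completion.

Section EllipticCurve.
Variable F : fieldType.

(* 16 times the discriminant of the cubic; its nonvanishing excludes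
   characteristic 2. *)
Definition ec_disc (a2 a4 a6 : F) : F :=
  16%:R * (a2 ^+ 2 * a4 ^+ 2 - 4%:R * a4 ^+ 3 - 4%:R * a2 ^+ 3 * a6
           - 27%:R * a6 ^+ 2 + 18%:R * a2 * a4 * a6).

(* The plane cubic y^2 = x^3 + a2 x^2 + a4 x + a6. *)
Record ell_curve := EllCurve {
  ec_a2 : F; ec_a4 : F; ec_a6 : F;
  ec_disc_neq0 : ec_disc ec_a2 ec_a4 ec_a6 != 0
}.

Variable E : ell_curve.
Let a2 := ec_a2 E.
Let a4 := ec_a4 E.
Let a6 := ec_a6 E.

(* [None] is the point at infinity. *)
Definition on_curve (p : option (F * F)) : bool :=
  if p is Some (x, y) then y ^+ 2 == x ^+ 3 + a2 * x ^+ 2 + a4 * x + a6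
  else true.

Record ec_point := ECPoint { ec_val : option (F * F); _ : on_curve ec_val }.
HB.instance Definition _ := [isSub for ec_val].
HB.instance Definition _ := [Choice of ec_point by <:].

Definition ec_slope (x1 y1 x2 y2 : F) : F :=
  if x1 == x2 then (3%:R * x1 ^+ 2 + 2%:R * a2 * x1 + a4) / (2%:R * y1)
  else (y2 - y1) / (x2 - x1).

(* Chord and tangent addition; the case [x1 = x2], [y1 <> - y2] is doubling. *)
Definition ec_add_val (p q : option (F * F)) : option (F * F) :=
  match p, q with
  | None, _ => q
  | _, None => p
  | Some (x1, y1), Some (x2, y2) =>
    if (x1 == x2) && (y1 == - y2) then None else
    let s := ec_slope x1 y1 x2 y2 in
    let x3 := s ^+ 2 - a2 - x1 - x2 in
    Some (x3, - (y1 + s * (x3 - x1)))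
  end.

Lemma ec_two_neq0 : 2%:R != 0 :> F.
Proof.
apply: contraNneq (ec_disc_neq0 E) => two0.
by rewrite /ec_disc (natrM F 2 8) two0 !mul0r.
Qed.

Lemma ec_chord x1 y1 x2 s : y1 ^+ 2 = x1 ^+ 3 + a2 * x1 ^+ 2 + a4 * x1 + a6 ->
    s * (2%:R * y1 + s * (x2 - x1)) =
      x1 ^+ 2 + x1 * x2 + x2 ^+ 2 + a2 * (x1 + x2) + a4 ->
  let x3 := s ^+ 2 - a2 - x1 - x2 in
  (- (y1 + s * (x3 - x1))) ^+ 2 = x3 ^+ 3 + a2 * x3 ^+ 2 + a4 * x3 + a6.
Proof.
move=> e1 es x3; rewrite /x3.
have -> : a6 = y1 ^+ 2 - (x1 ^+ 3 + a2 * x1 ^+ 2 + a4 * x1).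
  by rewrite e1; ring.
have -> : a4 = s * (2%:R * y1 + s * (x2 - x1)) -
               (x1 ^+ 2 + x1 * x2 + x2 ^+ 2 + a2 * (x1 + x2)).
  by rewrite es; ring.
by ring.
Qed.

Lemma ec_add_on_curve p q : on_curve p -> on_curve q -> on_curve (ec_add_val p q).
Proof.
case: p q => [[x1 y1]|] [[x2 y2]|] //= /eqP e1 /eqP e2.
case: ifPn => //; rewrite negb_and /ec_slope /=.
case: (eqVneq x1 x2) => [x12|x12] /= y12; apply/eqP; apply: ec_chord => //.
  move: e2; rewrite -x12 -e1 => /eqP.
  rewrite eqf_sqr (negPf (_ : y2 != - y1)) ?orbF => [/eqP yy|]; last first.
    by rewrite -eqr_oppLR eq_sym.
  have y10 : y1 != 0.
    by apply: contraNneq y12; rewrite yy => ->; rewrite oppr0.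
  have two0 := ec_two_neq0.
  by field; rewrite y10 two0.
have d0 : x2 - x1 != 0 by rewrite subr_eq0 eq_sym.
set s := (y2 - y1) / (x2 - x1).
have -> : s * (x2 - x1) = y2 - y1 by rewrite divfK.
apply: (mulfI d0); rewrite mulrA /s.
rewrite [_ * (_ / _)]mulrC divfK //.
have -> : (y2 - y1) * (2%:R * y1 + (y2 - y1)) = y2 ^+ 2 - y1 ^+ 2 by ring.
by rewrite e1 e2; ring.
Qed.

Definition ec_add (p q : ec_point) : ec_point :=
  ECPoint (ec_add_on_curve (valP p) (valP q)).

HB.instance Definition _ := Algebra.hasAdd.Build ec_point ec_add.

End EllipticCurve.

Section BaseChange.
Variables (F L : fieldType) (f : {rmorphism F -> L}) (E : ell_curve F).

Lemma base_change_disc :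
  ec_disc (f (ec_a2 E)) (f (ec_a4 E)) (f (ec_a6 E)) != 0.
Proof.
suff <- : f (ec_disc (ec_a2 E) (ec_a4 E) (ec_a6 E)) =
          ec_disc (f (ec_a2 E)) (f (ec_a4 E)) (f (ec_a6 E)).
  by rewrite fmorph_eq0 ec_disc_neq0.
by rewrite /ec_disc; ring.
Qed.

Definition base_change : ell_curve L := EllCurve base_change_disc.

End BaseChange.

(* E(L) carries the topology of a subspace of the projective plane, i.e. the
   quotient topology from the cone of homogeneous coordinates in L^3 \ 0. *)
Section PointTopology.
Variables (L : preTopologicalFieldType) (E : ell_curve L).

Definition ec_cone : set (L * L * L) := [set p | let: (X, Y, Z) := p in
  p != 0 /\ Y ^+ 2 * Z = X ^+ 3 + ec_a2 E * X ^+ 2 * Z + ec_a4 E * X * Z ^+ 2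
                        + ec_a6 E * Z ^+ 3].

Definition ec_of_coord (p : L * L * L) : option (L * L) :=
  let: (X, Y, Z) := p in if Z == 0 then None else Some (X / Z, Y / Z).

Lemma ec_of_coord_on_curve (p : ec_cone) : on_curve E (ec_of_coord (\val p)).
Proof.
case: p => -[[X Y] Z] /= /set_mem[_ e]; case: eqVneq => //= Z0; apply/eqP.
apply: (mulIf (expf_neq0 3 Z0)).
transitivity (Y ^+ 2 * Z); first by field.
by rewrite e; field.
Qed.

Definition ec_of_cone (p : ec_cone) : ec_point E :=
  ECPoint (ec_of_coord_on_curve p).

Definition ec_open (U : set (ec_point E)) : Prop := open (ec_of_cone @^-1` U).

Lemma ec_openT : ec_open setT.
Proof. by rewrite /ec_open preimage_setT; exact: openT. Qed.

Lemma ec_openI : setI_closed ec_open.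
Proof. by move=> A B oA oB; rewrite /ec_open preimage_setI; exact: openI. Qed.

Lemma ec_open_bigU (I : Type) (f : I -> set (ec_point E)) :
  (forall i, ec_open (f i)) -> ec_open (\bigcup_i f i).
Proof. by move=> of_; rewrite /ec_open preimage_bigcup; apply: bigcup_open => i _; exact: of_. Qed.

HB.instance Definition _ :=
  isOpenTopological.Build (ec_point E) ec_openT ec_openI ec_open_bigU.

End PointTopology.

HB.instance Definition _ (I : Type) (G : I -> Algebra.BaseAddMagma.type) :=
  Algebra.hasAdd.Build (prod_topology G) (fun f g i => f i + g i).

(* Only the operations are passed: a bijection between groups that preserves
   them is a group isomorphism. *)
Definition top_group_isomorphic (G H : topologicalType)
    (addG : G -> G -> G) (addH : H -> H -> H) : Prop :=
  exists (f : G -> H) (g : H -> G),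
    [/\ cancel f g, cancel g f, continuous f, continuous g
      & {morph f : x y / addG x y >-> addH x y}].

Definition adelic_points (R : realType) (K : fieldType) (E : ell_curve K) :=
  prod_topology (fun p : place R K =>
    ec_point (base_change (@to_completion R K (repr p)) E)).

(* Z/(m+1)Z *)
Definition Zmod (m : nat) : Type := 'I_m.+1.
HB.instance Definition _ m := GRing.Zmodule.on (Zmod m).
HB.instance Definition _ m :=
  Topological.copy (Zmod m) (discrete_topology 'I_m.+1).

Definition int_in (R : realType) : {pred R} := fun x => x \is a Num.int.

Lemma int_in_zmod (R : realType) : zmod_closed (@int_in R).
Proof. by split=> [|x y xi yi]; [exact: rpred0|exact: rpredB]. Qed.

HB.instance Definition _ (R : realType) :=
  GRing.isZmodClosed.Build R (@int_in R) (@int_in_zmod R).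

Definition RmodZ (R : realType) : Type :=
  quotient_topology {ideal_quot (@int_in R)}.
HB.instance Definition _ (R : realType) := Topological.on (RmodZ R).
HB.instance Definition _ (R : realType) :=
  GRing.Zmodule.copy (RmodZ R) {ideal_quot (@int_in R)}.

(* Profinite completion of Z: compatible families in the product of the
   discrete groups Z/(m+1)Z. *)
Definition Zhat_set : set (prod_topology (fun m => Zmod m)) := [set f | forall m k,
  (m.+1 %| k.+1)%N -> f m = (f k %% m.+1)%N :> nat].

Definition Zhat : Type := set_type Zhat_set.
HB.instance Definition _ := Topological.copy Zhat (set_type Zhat_set).

Lemma Zhat_add_subproof (f g : Zhat) : (\val f + \val g) \in Zhat_set.
Proof.
apply/mem_set => m k mk; case: f g => f /= /set_mem fP [g /= /set_mem gP].
rewrite -[LHS]/((f m + g m) %% m.+1)%N.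
rewrite -[RHS]/(((f k + g k) %% k.+1) %% m.+1)%N.
by rewrite modn_dvdm // (fP _ _ mk) (gP _ _ mk) modnDm.
Qed.

Definition Zhat_add (f g : Zhat) : Zhat := SigSub (Zhat_add_subproof f g).

HB.instance Definition _ := Algebra.hasAdd.Build Zhat Zhat_add.

Definition E_univ (R : realType) (n : nat) : Type :=
  (prod_topology (fun _ : 'I_n => RmodZ R) *
   prod_topology (fun _ : 'I_n => Zhat) *
   prod_topology (fun m => Zmod m))%type.
HB.instance Definition _ (R : realType) n := Topological.on (E_univ R n).
HB.instance Definition _ (R : realType) n := Algebra.BaseAddMagma.on (E_univ R n).

Lemma E_r_disc (r : rat) : r != 0 ->
  ec_disc (- (2%:R * (1 - 4%:R * r ^+ 4))) ((1 + 4%:R * r ^+ 4) ^+ 2) 0 != 0.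
Proof.
move=> r0; set d := ec_disc _ _ _.
have -> : d = - 1024%:R * r ^+ 4 * ((1 + 4%:R * r ^+ 4) ^+ 2) ^+ 2.
  by rewrite /d /ec_disc; ring.
have r4 : 1 + 4%:R * r ^+ 4 != 0.
  apply: lt0r_neq0; apply: ltr_pwDl; first exact: ltr01.
  by apply: mulr_ge0; [exact: ler0n|exact: exprn_even_ge0].
have c0 : 1024%:R != 0 :> rat by rewrite pnatr_eq0.
apply: mulf_neq0; last by apply: expf_neq0; apply: expf_neq0.
by apply: mulf_neq0; [rewrite oppr_eq0|apply: expf_neq0].
Qed.

(* y^2 = x (x^2 - 2 (1 - 4 r^4) x + (1 + 4 r^4)^2) *)
Definition E_r (r : rat) (r0 : r != 0) : ell_curve rat := EllCurve (E_r_disc r0).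

(* Main.v *)
Require Import Defs.
From mathcomp Require Import all_boot all_order all_algebra all_field.
From mathcomp Require Import all_classical all_reals all_analysis.
From mathcomp Require Import ring.

Import GRing.Theory.

Local Open Scope ring_scope.

(** Every 2-torsion point of [E_r] over an extension [L] of [Q] is divisible by
    2: the rational point [(0, 0)] is twice [(c, 4 c r^2)] with [c = 1 + 4 r^4],
    and as soon as [L] contains a second 2-torsion point it contains a square
    root of -1, over which the whole 4-torsion of [E_r] is defined. Hence the
    2-torsion elements of the adelic point group are all divisible by 2, whereas
    the generator of the factor [Z/2Z] of [E_n] is not. *)

Section TwoTorsion.
Variables (L : fieldType) (E : ell_curve L).

(** For an affine [z] with [y] different from [- y], keeping the abscissa turns [y] into [- y]. As
    [ec_point] carries an addition but no declared zero, idempotence is how the point at infinity is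
    recognised. *)
Lemma ec_add_idem (z : ec_point E) : z + z = z -> ec_val z = None.
Proof.
move=> /(congr1 (@ec_val _ E)); case: z => -[[x y]|] //= _.
rewrite eqxx /=; case: ifPn => // y0 [xE /eqP].
by rewrite xE subrr mulr0 addr0 eq_sym (negPf y0).
Qed.

Lemma ec_double_None (z : ec_point E) : ec_val (z + z) = None ->
  ec_val z = None \/ exists x, ec_val z = Some (x, 0).
Proof.
case: z => -[[x y]|] //=; last by left.
rewrite eqxx /=; case: ifP => // /eqP yN _ _; right; exists x.
have /eqP : 2%:R * y = 0 by rewrite mulr_natl mulr2n {1}yN addNr.
by rewrite mulf_eq0 (negPf (ec_two_neq0 E)) /= => /eqP ->.
Qed.

(* [s] is the slope of the tangent at [(x, y)]. *)
Lemma ec_halve (x y s : L) (z : ec_point E) : y != 0 -> on_curve E (Some (x, y)) ->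
    s * (2%:R * y) = 3%:R * x ^+ 2 + 2%:R * ec_a2 E * x + ec_a4 E ->
    ec_val z = Some (s ^+ 2 - ec_a2 E - x - x,
      - (y + s * (s ^+ 2 - ec_a2 E - x - x - x))) ->
  exists p : ec_point E, p + p = z.
Proof.
move=> y0 oc es ez; exists (ECPoint oc); apply: val_inj; rewrite /= ez.
have y2 : 2%:R * y != 0 by rewrite mulf_neq0 ?ec_two_neq0.
rewrite eqxx ifF; last first.
  by apply: contraNF y2 => /eqP yN; rewrite mulr_natl mulr2n {1}yN addNr.
by rewrite /ec_slope eqxx -es mulfK.
Qed.

Variable t : L.
Hypothesis a2E : ec_a2 E = - (2%:R * (1 - 4%:R * t ^+ 4)).
Hypothesis a4E : ec_a4 E = (1 + 4%:R * t ^+ 4) ^+ 2.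
Hypothesis a6E : ec_a6 E = 0.

Lemma E_r_two_torsion_divisible (z : ec_point E) :
  ec_val (z + z) = None -> exists p : ec_point E, p + p = z.
Proof.
have := ec_disc_neq0 E; rewrite a2E a4E a6E.
set d := ec_disc _ _ _.
have -> : d = - 1024%:R * t ^+ 4 * (1 + 4%:R * t ^+ 4) ^+ 4.
  by rewrite /d /ec_disc; ring.
move=> disc0.
have t0 : t != 0.
  by apply: contraNneq disc0 => ->; rewrite expr0n mulr0 mul0r.
have c0 : 1 + 4%:R * t ^+ 4 != 0.
  by apply: contraNneq disc0 => ->; rewrite expr0n mulr0.
have two0 := ec_two_neq0 E.
have four0 : 4%:R != 0 :> L by rewrite (natrM _ 2 2) mulf_neq0.
move=> /ec_double_None [zN|[x zx]].
  by exists z; apply: val_inj; rewrite /= zN.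
have := valP z; rewrite /= zx /= a2E a4E a6E expr0n /= => /eqP.
have [x0 _|x0] := eqVneq x 0.
  (* The tangent at a half of (0, 0) is a line [y = s x]. With [c = 1 + 4 t^4], it meets the curve
     again where [x^2 + (a2 - s^2) x + c^2] vanishes, which is [(x - c)^2] for
     [s^2 = a2 + 2 c = (4 t^2)^2]. *)
  apply: (@ec_halve (1 + 4%:R * t ^+ 4) (4%:R * (1 + 4%:R * t ^+ 4) * t ^+ 2)
    (4%:R * t ^+ 2)); rewrite ?a2E ?a4E ?a6E //.
  - by rewrite !mulf_neq0 ?expf_neq0.
  - by rewrite /= a2E a4E a6E; apply/eqP; ring.
  - by ring.
  - by rewrite zx x0; congr (Some (_, _)); ring.
move=> ex.
(* The quadratic factor of the cubic has reduced discriminant [(1 - 4 t^4)^2 - (1 + 4 t^4)^2 = - (4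
   t^2)^2], so its root [x] yields a square root of -1. *)
pose i := (x - (1 - 4%:R * t ^+ 4)) / (4%:R * t ^+ 2).
have xi : x = 1 - 4%:R * t ^+ 4 + 4%:R * i * t ^+ 2.
  by rewrite /i; field; rewrite four0 t0.
have i2 : i ^+ 2 = -1.
  have e0 : (x - (1 - 4%:R * t ^+ 4)) ^+ 2 = - (4%:R * t ^+ 2) ^+ 2.
    by apply: (mulfI x0); apply/subr0_eq; apply: etrans (esym ex); ring.
  by rewrite /i expr_div_n e0 mulNr mulfV // expf_neq0 ?mulf_neq0 ?expf_neq0.
(* The roots of the cubic are 0, [a ^+ 2] and [b ^+ 2], and
   [a ^+ 2 - b ^+ 2 = (2 (1 + i) t) ^+ 2]. *)
pose a := 1 + 2%:R * i * t ^+ 2; pose b := 1 - 2%:R * i * t ^+ 2.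
pose e := 2%:R * (1 + i) * t.
have xa : x = a ^+ 2 by rewrite xi /a; ring: i2.
have ab : a * b = 1 + 4%:R * t ^+ 4 by rewrite /a /b; ring: i2.
have e2 : e ^+ 2 = a ^+ 2 - b ^+ 2 by rewrite /a /b /e; ring: i2.
have s2 : a ^+ 2 + b ^+ 2 = 2%:R * (1 - 4%:R * t ^+ 4) by rewrite /a /b; ring: i2.
have : a * b != 0 by rewrite ab.
rewrite mulf_eq0 negb_or => /andP[a0 b0].
have ae0 : a + e != 0.
  have : (a + e) * (a - e) != 0.
    by rewrite mulrC -subr_sqr e2 opprB addrC subrK expf_neq0.
  by rewrite mulf_eq0 negb_or => /andP[].
have e0 : e != 0.
  (* [1 + i] divides [1 - i^2 = 2], which is nonzero in [L]. *)
  rewrite /e !mulf_neq0 //; apply/eqP => i1; move/eqP: two0; apply.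
  have -> : 2%:R = 1 - i ^+ 2 by rewrite i2 opprK.
  by rewrite -[1 in LHS](expr1n _ 2) subr_sqr i1 mulr0.
have B2 : b ^+ 2 = a ^+ 2 - e ^+ 2 by rewrite e2 opprB addrC subrK.
have a2E' : ec_a2 E = - (a ^+ 2 + b ^+ 2) by rewrite a2E s2.
have a4E' : ec_a4 E = a ^+ 2 * b ^+ 2 by rewrite a4E -ab exprMn.
(* The root [a^2] differs from the other two by the squares [a^2] and [e^2]. At abscissa [a^2 + a e]
   the cubic is therefore the product of [a (a + e)], [a e] and [e (a + e)], a square. *)
apply: (@ec_halve (a * (a + e)) (a * e * (a + e)) (a + e));
  rewrite /= ?a2E' ?a4E' ?a6E ?B2.
- exact: mulf_neq0 (mulf_neq0 a0 e0) ae0.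
- by apply/eqP; ring.
- by ring.
- by rewrite zx xa; congr (Some (_, _)); ring.
Qed.

End TwoTorsion.

Theorem theorem5p6 (R : realType) (K : fieldExtType rat) (n : nat)
    (degK : \dim {: K} = n) (r : rat) (r0 : r != 0) :
  ~ top_group_isomorphic
      (G := adelic_points R (base_change (GRing.in_alg K) (E_r r0)))
      (H := E_univ R n) +%R +%R.
Proof.
move=> [f [g [fK gK _ _ fD]]].
have gD : {morph g : x y / x + y}.
  by move=> x y; apply: (can_inj fK); rewrite fD !gK.
have zhat0 : (fun m => 0 : Zmod m) \in Zhat_set.
  by apply/mem_set => m k _; rewrite mod0n.
pose Z0 : Zhat := SigSub zhat0.
pose O : E_univ R n := (fun=> 0, fun=> Z0, fun=> 0).
(* Index 1 is the factor Z/2Z, since [Zmod m] has order [m + 1]. *)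
pose u : E_univ R n := (fun=> 0, fun=> Z0, fun m => if m == 1%N then inZp 1 else 0).
have Z00 : Z0 + Z0 = Z0.
  by apply: val_inj; apply: functional_extensionality_dep => m; exact: addr0.
have OO : O + O = O.
  congr (_, _, _); apply: functional_extensionality_dep => i; last exact: addr0.
    exact: addr0.
  exact: Z00.
have uu : u + u = O.
  congr (_, _, _); apply: functional_extensionality_dep => i.
  - exact: addr0.
  - exact: Z00.
  - rewrite -[LHS]/((if i == 1%N then inZp 1 else 0) +
      (if i == 1%N then inZp 1 else 0)).
    by case: eqP => [->|_]; [apply: val_inj | rewrite addr0].
have half p : exists q, q + q = g u p.
  apply: (@E_r_two_torsion_divisible _ _
    (to_completion (repr p) (GRing.in_alg K r))).
  - rewrite [LHS](_ : _ = to_completion (repr p)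
      (GRing.in_alg K (- (2%:R * (1 - 4%:R * r ^+ 4))))) //.
    by rewrite !(rmorphN, rmorphM, rmorphB, rmorphD, rmorphXn, rmorph_nat, rmorph1).
  - rewrite [LHS](_ : _ = to_completion (repr p)
      (GRing.in_alg K ((1 + 4%:R * r ^+ 4) ^+ 2))) //.
    by rewrite !(rmorphM, rmorphD, rmorphXn, rmorph_nat, rmorph1).
  - by rewrite /= scale0r rmorph0.
  (* [g u + g u = g O] is idempotent because [O + O = O]. *)
  - apply: ec_add_idem.
    have /(congr1 (fun h => h p)) := gD O O.
    by rewrite OO -uu gD.
pose q : adelic_points R (base_change (GRing.in_alg K) (E_r r0)) :=
  fun p => sval (cid (half p)).
have : f q + f q = u.
  rewrite -fD -[RHS]gK; congr f; apply: functional_extensionality_dep => p.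
  exact: (svalP (cid (half p))).
(* In Z/2Z every double is 0, whereas the component of [u] there is 1. *)
move=> /(congr1 (fun h : E_univ R n => h.2 1%N)) /(congr1 val) /=.
by case: (f q) => h k /=; case: (k 1%N) => [[|[|]]].
Qed.
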